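(* Let $\Theta\subset[0,1]$ be a countable class of parameters and $\theta_0\in\Theta$ the true parameter. Assume that there are constants $a\ge1$ and $b\ge0$ such that $$\min\big\{K_w(\theta):\theta\in[\theta_0-2^{-k},\theta_0+2^{-k}]\cap\Theta,\ \theta\ne\theta_0\big\}\;\ge\;\frac{k-b}{a}$$ holds for all $k>aK_w(\theta_0)+b$. Then $$\sum_{n=1}^\infty\mathbf{E}\big(\theta_0-\theta^{x_{1:n}}\big)^2\;\stackrel{\times}{\leq}\;aK_w(\theta_0)+b\;\stackrel{\times}{\leq}\;K_w(\theta_0),$$ where $f\stackrel{\times}{\leq}g$ means $f=O(g)$.
   Context: Each $\theta\in\Theta$ has a complexity (description length) $K_w(\theta)\ge0$, not necessarily an integer, and weight $w_\theta=2^{-K_w(\theta)}$. The weights are not required to sum to at most one. For a binary string $x$ of length $n$ with $\mathbf 1(x)$ ones let $P(x|\theta)=\theta^{\mathbf 1(x)}(1-\theta)^{n-\mathbf 1(x)}$. The MDL estimator is $\theta^x=\arg\max_{\theta\in\Theta}\{w_\theta P(x|\theta)\}$. $\mathbf{E}$ is expectation when $x_{1:n}=x_1\dots x_n$ consists of i.i.d. bits with $P(x_i=1)=\theta_0$.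
   Formalization: O(.) is read away from zero: for each κ>0 the first bound has a constant depending only on κ, for K_w(θ0)+b/a ≥ κ; the second has a constant depending on a, b, κ, for K_w(θ0) ≥ κ. Without this the bounds fail, e.g. when K_w(θ0)=b=0. *)

(* Defs.v *)
From mathcomp Require Import all_boot all_order all_algebra.
From mathcomp Require Import all_classical all_reals all_analysis.

Set Implicit Arguments.
Unset Strict Implicit.
Unset Printing Implicit Defensive.

Import Order.TTheory GRing.Theory Num.Theory.
Import numFieldNormedType.Exports.
Local Open Scope classical_set_scope.
Local Open Scope ring_scope.

Section MDL.
Variable R : realType.
Implicit Types (Theta : set R) (theta a b : R) (Kw : R -> R).

Definition weight Kw theta : R := 2 `^ (- Kw theta).

Definition ones (x : seq bool) : nat := count_mem true x.

(* Since 0 ^+ 0 = 1, theta = 0 and theta = 1 give probability 1 to the constant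
   strings of zeros and of ones. *)
Definition likelihood (x : seq bool) theta : R :=
  theta ^+ ones x * (1 - theta) ^+ (size x - ones x).

(* A map on strings choosing a maximizer of [weight * likelihood] in Theta, with
   arbitrary tie-breaking.  The empty string is left unconstrained, because only
   lengths n >= 1 are summed over. *)
Definition mdl_estimator Theta Kw (est : seq bool -> R) : Prop :=
  forall x : seq bool, x != [::] ->
    Theta (est x) /\
    forall theta, Theta theta ->
      weight Kw theta * likelihood x theta
        <= weight Kw (est x) * likelihood x (est x).

(* Expectation over n i.i.d. bits, each equal to 1 with probability theta0. *)
Definition expectation_iid (theta0 : R) (n : nat) (f : seq bool -> R) : R :=
  \sum_(x : n.-tuple bool) likelihood x theta0 * f x.

Definition cumulative_sq_loss (theta0 : R) (est : seq bool -> R) : \bar R :=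
  (\sum_(1 <= n <oo)
     (expectation_iid theta0 n (fun x => (theta0 - est x) ^+ 2))%:E)%E.

Definition punctured_neighbourhood Theta (theta0 : R) (k : nat) : set R :=
  [set theta | [/\ theta0 - 2 ^- k <= theta <= theta0 + 2 ^- k,
                   Theta theta & theta != theta0]].

(* The infimum of the empty set is +oo, so a k whose punctured neighbourhood
   misses Theta imposes no constraint. *)
Definition complexity_growth Theta Kw (theta0 : R) a b : Prop :=
  forall k : nat, a * Kw theta0 + b < k%:R ->
    (((k%:R - b) / a)%R%:E <=
     ereal_inf [set (Kw theta)%:E |
                theta in punctured_neighbourhood Theta theta0 k])%E.

Record mdl_setting Theta Kw (theta0 : R) (est : seq bool -> R) a b : Prop := {
  mdl_Theta01 : Theta `<=` `[0, 1];
  mdl_countable : countable Theta;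
  mdl_Kw_ge0 : forall theta, Theta theta -> 0 <= Kw theta;
  mdl_theta0 : Theta theta0;
  mdl_est : mdl_estimator Theta Kw est;
  mdl_a_ge1 : 1 <= a;
  mdl_b_ge0 : 0 <= b;
  mdl_growth : complexity_growth Theta Kw theta0 a b }.

End MDL.

(* Main.v *)
Require Import Defs.
From mathcomp Require Import all_boot all_order all_algebra.
From mathcomp Require Import all_classical all_reals all_analysis.
From mathcomp Require Import ring lra.

(** The second bound is arithmetic: [b <= (b / kappa) * Kw theta0].  For the first
one, write [K0] for [Kw theta0] and [M] for [a * K0 + b].  Cut the line around
[theta0] into dyadic shells, the [k]-th one holding the points at distance between
[2^-(k+1)] and [2^-k].  An estimate in shell [k] costs at most [4^-k], so it
suffices to bound, for each [k], the expected number of times [n] at which the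
estimate lies in shell [k], and to sum these numbers against [4^-k].

One inequality bounds every such probability.  Let [e] be [2^-(k+1)] or its
opposite.  If the estimator picks [t] beyond [theta0 + e] although some [s] in
[Theta] much closer to [theta0] is available, then [t] beats [s] in weighted
likelihood.  The likelihood is log-concave in its parameter, so the point
[theta0 + e], which lies between [s] and [t] and does not depend on the sample,
already beats [s] up to a controlled power of the weights
([likelihood_ratio_segment]).  A single test between two fixed parameters remains,
whatever the number of candidates in the shell, and Markov's inequality for the
square root of the likelihood ratio ([likelihood_ratio_tail]) bounds its
probability by an [n]-th power of a Hellinger-type affinity times a power of the
ratio of the weights.  Once it drops below 1 the bound decreases geometrically, so
that summing over [n] costs only the logarithm of the weight factor
([sum_capped_geometric_le]).

The choice of [s] depends on the shell.

- Fine shells, [k > M].  Take [s = theta0].  The growth hypothesis makes the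
  candidates in the shell more complex than [theta0] by [(k - M) / a], which yields
  a factor decaying exponentially in [k - M] at rate of order [1 / a].  The total
  is of order [a].

- Coarse shells reaching across the boundary of [[0, 1]], at distance [|e|] larger
  than [theta0] or than [1 - theta0].  Take [s = theta0] again.  Near the boundary
  the affinity deficit is linear, not quadratic, in [|e|], so that shell [k]
  contributes at most a constant times [2^-k * K0 + 1].

- The other coarse shells.  Taking [s = theta0] would cost [K0] for each of the [M]
  shells, hence [M * K0].  Instead let [s] almost attain the least complexity
  [profile (k + 7)] available at scale [2^-(k+7)].  Candidates in shell [k] have
  complexity at least [profile k], so the cost of the shell is
  [profile (k + 7) - profile k] plus a constant, and these increments telescope to
  [7 * K0] ([sum_complexity_profile_increments]).

Altogether the loss is at most a constant times [M + a] ([cumulative_sq_loss_le]),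
and [kappa <= K0 + b / a] says exactly that [a <= M / kappa]. *)

Set Implicit Arguments.
Unset Strict Implicit.
Unset Printing Implicit Defensive.

Import Order.TTheory GRing.Theory Num.Theory.
Import numFieldNormedType.Exports.
Local Open Scope classical_set_scope.
Local Open Scope ring_scope.

(** * Likelihoods of bit strings *)

Definition bernoulli_mass (R : realType) (t : R) (b : bool) : R :=
  if b then t else 1 - t.

Lemma bernoulli_mass_ge0 (R : realType) (t : R) (b : bool) :
  0 <= t <= 1 -> 0 <= bernoulli_mass t b.
Proof. by case: b => /= /andP[? ?] //; rewrite subr_ge0. Qed.

Lemma likelihood_prod (R : realType) (x : seq bool) (t : R) :
  likelihood x t = \prod_(b <- x) bernoulli_mass t b.
Proof.
rewrite /likelihood /ones; elim: x => [|b x IHx]; first by rewrite big_nil mulr1.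
rewrite big_cons -IHx /=; have sz := count_size (pred1 true) x.
case: b => /=; first by rewrite add1n subSS exprS mulrA.
by rewrite add0n subSn // exprS mulrCA.
Qed.

(* Keeps lemmas on products from seeing through the likelihood, which is itself
   a product. *)
Local Opaque likelihood.

Lemma likelihood_ge0 (R : realType) (x : seq bool) (t : R) :
  0 <= t <= 1 -> 0 <= likelihood x t.
Proof.
move=> t01; rewrite likelihood_prod; apply: prodr_ge0 => b _.
exact: bernoulli_mass_ge0.
Qed.

Lemma sum_tuple_prod (R : comPzRingType) (T : finType) (n : nat) (h : T -> R) :
  \sum_(x : n.-tuple T) \prod_(b <- x) h b = (\sum_b h b) ^+ n.
Proof.
rewrite -[in RHS](card_ord n) -prodr_const bigA_distr_bigA /=.
rewrite (reindex (@finfun_of_tuple T n)) /=; last first.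
  by exists (@tuple_of_finfun T n) => ? _; [exact: finfun_of_tupleK|exact: tuple_of_finfunK].
apply: eq_bigr => x _; rewrite big_tuple; apply: eq_bigr => i _.
by rewrite ffunE.
Qed.

Lemma sum_likelihood (R : realType) (n : nat) (t : R) :
  \sum_(x : n.-tuple bool) likelihood x t = 1.
Proof.
under eq_bigr do rewrite likelihood_prod.
by rewrite sum_tuple_prod big_bool /= addrC subrK expr1n.
Qed.

Lemma weighted_AMGM (R : realType) (l x y : R) :
  0 < l < 1 -> 0 <= x -> 0 <= y ->
  x `^ (1 - l) * y `^ l <= (1 - l) * x + l * y.
Proof.
move=> /andP[l0 l1] x0 y0.
have := @conjugate_powR R (x `^ (1 - l)) (y `^ l) (1 - l)^-1 l^-1.
rewrite !invrK subrK -!powRrM !mulfV ?powRr1 //; [|lra..].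
rewrite [x * _]mulrC [y * _]mulrC; apply; rewrite ?powR_ge0 ?invr_gt0 //; lra.
Qed.

(** The logarithm of the likelihood is a sum of terms [ln t] and [ln (1 - t)], all
concave in [t].  Powers take the place of logarithms, as the likelihood may
vanish. *)
Lemma likelihood_log_concave (R : realType) (x : seq bool) (l s t : R) :
  0 < l < 1 -> 0 <= s <= 1 -> 0 <= t <= 1 ->
  likelihood x s `^ (1 - l) * likelihood x t `^ l
    <= likelihood x ((1 - l) * s + l * t).
Proof.
move=> l01 s01 t01; rewrite !likelihood_prod.
elim: x => [|b x IHx]; first by rewrite !big_nil !powR1 mulr1.
have p0 r : 0 <= r <= 1 -> 0 <= \prod_(b <- x) @bernoulli_mass R r b.
  by move=> r01; apply: prodr_ge0 => b' _; apply: bernoulli_mass_ge0.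
rewrite !big_cons !powRM ?bernoulli_mass_ge0 ?p0 // mulrACA.
apply: ler_pM => //; rewrite ?mulr_ge0 ?powR_ge0 //.
have := weighted_AMGM l01 (bernoulli_mass_ge0 b s01) (bernoulli_mass_ge0 b t01).
by move/le_trans; apply; case: b => /=; lra.
Qed.

(** Replaces a parameter [t] that depends on the sample by a fixed point on the
segment from [s] to [t], at the price of the power [l] of the ratio. *)
Lemma likelihood_ratio_segment (R : realType) (x : seq bool) (l s t c : R) :
  0 < l < 1 -> 0 <= s <= 1 -> 0 <= t <= 1 ->
  expR c * likelihood x s <= likelihood x t ->
  expR (l * c) * likelihood x s <= likelihood x ((1 - l) * s + l * t).
Proof.
move=> l01 s01 t01 H; have [l0 l1] := andP l01.
apply: le_trans (likelihood_log_concave x l01 s01 t01).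
have s0 := likelihood_ge0 x s01.
have H' : (expR c * likelihood x s) `^ l <= likelihood x t `^ l.
  apply: ge0_ler_powR; rewrite ?(ltW l0) ?nnegrE //.
    by rewrite mulr_ge0 ?expR_ge0.
  exact: likelihood_ge0.
apply: le_trans (ler_wpM2l (powR_ge0 _ _) H').
rewrite powRM ?expR_ge0 // -expRM [leRHS]mulrCA -powRD subrK ?oner_eq0 //.
by rewrite powRr1 // [c * l]mulrC.
Qed.

(** The expectation, for one bit of parameter [r], of the square root of the
likelihood ratio of [t] to [s].  For [s = r] it is the Hellinger affinity of the
two Bernoulli laws; the three parameters are needed to compare [t] with an [s]
that is not the true parameter. *)
Definition affinity (R : realType) (r s t : R) : R :=
  \sum_(b : bool) bernoulli_mass r b *
     (Num.sqrt (bernoulli_mass t b) / Num.sqrt (bernoulli_mass s b)).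

Lemma affinity_exp (R : realType) (n : nat) (r s t : R) :
  0 <= s <= 1 -> 0 <= t <= 1 ->
  affinity r s t ^+ n = \sum_(x : n.-tuple bool) likelihood x r *
     (Num.sqrt (likelihood x t) / Num.sqrt (likelihood x s)).
Proof.
move=> s01 t01; rewrite -sum_tuple_prod; apply: eq_bigr => x _.
rewrite !likelihood_prod; elim: (val x) => [|b y IHy].
  by rewrite !big_nil sqrtr1 divr1 mulr1.
rewrite !big_cons !sqrtrM ?bernoulli_mass_ge0 // IHy invfM.
by rewrite mulrACA; congr (_ * _); rewrite mulrACA.
Qed.

(** Absolute continuity: where [s] excludes a string, so does the true parameter
[r].  Strings on which the quotients in [affinity] are divisions by zero then carry
no mass. *)
Lemma likelihood_eq0_dominated (R : realType) (x : seq bool) (r s : R) :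
  (s = 0 -> r = 0) -> (s = 1 -> r = 1) ->
  likelihood x s = 0 -> likelihood x r = 0.
Proof.
move=> s0 s1; rewrite !likelihood_prod => /eqP.
rewrite prodf_seq_eq0 => /hasP[b bx /= /eqP sb0]; apply/eqP.
rewrite prodf_seq_eq0; apply/hasP; exists b => //=; apply/eqP.
by case: b sb0 {bx} => /=; [exact: s0|move/eqP; rewrite subr_eq0 eq_sym => /eqP/s1 ->; rewrite subrr].
Qed.

(** Markov's inequality for the square root of the likelihood ratio, whose
expectation factors over the independent bits.  The exponent 1/2 makes the bound
exponentially small when [s] is equal or close to [r]; the exponent 1 would give
no decay at all for [s = r]. *)
Lemma likelihood_ratio_tail (R : realType) (n : nat) (r s t c : R)
    (E : pred (n.-tuple bool)) :
  0 <= r <= 1 -> 0 <= s <= 1 -> 0 <= t <= 1 ->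
  (s = 0 -> r = 0) -> (s = 1 -> r = 1) ->
  (forall x, E x -> expR c * likelihood x s <= likelihood x t) ->
  \sum_(x | E x) likelihood x r <= expR (- (c / 2)) * affinity r s t ^+ n.
Proof.
move=> r01 s01 t01 s0 s1 EL; rewrite affinity_exp // mulr_sumr.
rewrite [leRHS](bigID E) /= -[leLHS]addr0 lerD ?sumr_ge0 //; last first.
  move=> x _; apply: mulr_ge0; first exact: expR_ge0.
  by rewrite mulr_ge0 ?likelihood_ge0 // divr_ge0 ?sqrtr_ge0.
apply: ler_sum => x /EL H.
have [Ls0|Ls0] := eqVneq (likelihood x s) 0.
  by rewrite (likelihood_eq0_dominated s0 s1 Ls0) mul0r mulr0.
have Ls : 0 < likelihood x s by rewrite lt_neqAle eq_sym Ls0 likelihood_ge0.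
rewrite mulrCA ler_peMr ?likelihood_ge0 // expRN.
rewrite mulrC ler_pdivlMr ?expR_gt0 // mul1r ler_pdivlMr ?sqrtr_gt0 //.
apply: le_trans (ler_wsqrtr H).
rewrite (sqrtrM _ (expR_ge0 c)) ler_pM2r ?sqrtr_gt0 //.
have -> : expR c = expR (c / 2) ^+ 2 by rewrite -expRM_natl; congr expR; lra.
by rewrite sqrtr_sqr ger0_norm ?expR_ge0.
Qed.

(** * Bounds on the affinity *)

Lemma affinity_diagE (R : realType) (r t : R) :
  affinity r r t
    = Num.sqrt r * Num.sqrt t + Num.sqrt (1 - r) * Num.sqrt (1 - t).
Proof.
have divs (x : R) : x / Num.sqrt x = Num.sqrt x.
  have [x0|x0] := lerP x 0; first by rewrite ler0_sqrtr // invr0 mulr0.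
  by rewrite -{1}(sqr_sqrtr (ltW x0)) expr2 mulfK // gt_eqF ?sqrtr_gt0.
rewrite /affinity big_bool /= (mulrCA r) (mulrCA (1 - r)) !divs.
by rewrite mulrC [X in _ + X]mulrC.
Qed.

(** One minus the affinity is half the squared Hellinger distance, and square
roots of numbers in [[0, 1]] are at least half as far apart as the numbers. *)
Lemma affinity_diag_le (R : realType) (r t : R) :
  0 <= r <= 1 -> 0 <= t <= 1 -> affinity r r t <= 1 - (t - r) ^+ 2 / 4.
Proof.
move=> /andP[r0 r1] /andP[t0 t1]; rewrite affinity_diagE.
have sq01 (x : R) : 0 <= x -> x <= 1 ->
    [/\ 0 <= Num.sqrt x, Num.sqrt x <= 1 & Num.sqrt x ^+ 2 = x].
  by move=> x0 x1; rewrite sqrtr_ge0 sqr_sqrtr // -[X in _ <= X]sqrtr1 ler_wsqrtr.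
have [||x0 x1 xE] := sq01 r => //; have [||y0 y1 yE] := sq01 t => //.
have [||x'0 x'1 x'E] := sq01 (1 - r); [lra..|].
have [||y'0 y'1 y'E] := sq01 (1 - t); [lra..|].
move: (Num.sqrt r) (Num.sqrt t) (Num.sqrt (1 - r)) (Num.sqrt (1 - t))
  x0 x1 xE y0 y1 yE x'0 x'1 x'E y'0 y'1 y'E => x y x' y'.
move=> x0 x1 xE y0 y1 yE x'0 x'1 x'E y'0 y'1 y'E.
have sq_le (p q : R) : 0 <= p -> p <= 1 -> 0 <= q -> q <= 1 ->
    (p ^+ 2 - q ^+ 2) ^+ 2 <= 4 * (p - q) ^+ 2.
  move=> p0 p1 q0 q1; rewrite subr_sqr exprMn mulrC ler_wpM2r ?sqr_ge0 //.
  by rewrite (_ : 4 = 2 ^+ 2) ?lerXn2r ?nnegrE //; [lra..|ring].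
have := sq_le y x y0 y1 x0 x1; have := sq_le y' x' y'0 y'1 x'0 x'1.
rewrite xE yE x'E y'E => h' h.
have -> : x * y + x' * y' = 1 - ((y - x) ^+ 2 + (y' - x') ^+ 2) / 2.
  by rewrite !sqrrB xE yE x'E y'E; field.
have tr : (1 - t - (1 - r)) ^+ 2 = (t - r) ^+ 2 by ring.
by rewrite tr in h'; lra.
Qed.

(** When [t - r > r], the root of [t] is of order the root of [t - r] and exceeds
that of [r] by a fixed proportion, so the squared Hellinger distance is linear in
[t - r].  The other case is the same after exchanging zeros and ones. *)
Lemma affinity_boundary_le (R : realType) (r t : R) :
  0 <= r <= 1 -> 0 <= t <= 1 -> r < `|t - r| \/ 1 - r < `|t - r| ->
  affinity r r t <= 1 - `|t - r| / 12.
Proof.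
have aux (p q p' q' : R) : 0 <= p -> 0 <= q -> 0 <= p' -> 0 <= q' ->
    p ^+ 2 + p' ^+ 2 = 1 -> q ^+ 2 + q' ^+ 2 = 1 ->
    p ^+ 2 < q ^+ 2 - p ^+ 2 ->
    p * q + p' * q' <= 1 - (q ^+ 2 - p ^+ 2) / 12.
  move=> p0 q0 p'0 q'0 pE qE far.
  (* p and q are the roots of r and t: (q + p)^2 <= 2 (p^2 + q^2) <= 6 (q^2 - p^2). *)
  have pq : (q ^+ 2 - p ^+ 2) / 6 <= (q - p) ^+ 2.
    have e0 : 0 < q ^+ 2 - p ^+ 2 by nra.
    rewrite -(ler_pM2l e0).
    have : (q ^+ 2 - p ^+ 2) ^+ 2 = (q - p) ^+ 2 * (q + p) ^+ 2 by ring.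
    have : (q + p) ^+ 2 <= 6 * (q ^+ 2 - p ^+ 2) by nra.
    have := sqr_ge0 (q - p).
    nra.
  have := sqr_ge0 (p' - q'); nra.
move=> /andP[r0 r1] /andP[t0 t1]; rewrite affinity_diagE.
case: (lerP r t) => rt far.
  have far' : r < t - r by case: far; lra.
  have := aux (Num.sqrt r) (Num.sqrt t) (Num.sqrt (1 - r)) (Num.sqrt (1 - t)).
  rewrite !sqr_sqrtr ?sqrtr_ge0; [|lra..]; apply; lra.
have far' : 1 - r < r - t by case: far; lra.
have := aux (Num.sqrt (1 - r)) (Num.sqrt (1 - t)) (Num.sqrt r) (Num.sqrt t).
rewrite !sqr_sqrtr ?sqrtr_ge0; [|lra..]; move=> h.
by rewrite addrC; apply: le_trans (h _ _ _ _ _ _ _) _ => //; lra.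
Qed.

(** The tangent of the square root at 1, with a quadratic gain: for [z] the root of
[y], the difference is [(z - 1)^2 * (9 - (z + 1)^2) / 18]. *)
Lemma sqrt_le_parabola (R : realType) (y : R) : 0 <= y <= 4 ->
  Num.sqrt y <= (1 + y) / 2 - (y - 1) ^+ 2 / 18.
Proof.
move=> /andP[y0 y4]; have z0 := sqrtr_ge0 y.
have z2 : Num.sqrt y <= 2.
  by rewrite -(@ler_pXn2r _ 2) ?nnegrE ?sqr_sqrtr //; lra.
rewrite -{2 3}(sqr_sqrtr y0); move: (Num.sqrt y) z0 z2 => z z0 z2.
have : 0 <= (z - 1) ^+ 2 * ((2 - z) * (z + 4)).
  by rewrite mulr_ge0 ?sqr_ge0 // mulr_ge0; lra.
lra.
Qed.

(** With [s = r] this is the quadratic decay of the Hellinger affinity.  Moving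
[s] away from [r] adds a first-order term [(s - r) * (t - s) / 2], and both terms
carry the same factor [1 / s + 1 / (1 - s)], the inverse variance at [s].  The added
term is therefore dominated as soon as [s - r] is a small fraction of [t - r],
uniformly in the position of [r], provided that [t] is no
farther from [r] than the boundary is: this keeps the ratios of masses bounded by 4. *)
Lemma affinity_interior_le (R : realType) (r s t : R) :
  t != r -> `|t - r| <= r -> `|t - r| <= 1 - r -> 64 * `|s - r| <= `|t - r| ->
  affinity r s t <= 1 - (t - r) ^+ 2 / 36.
Proof.
move=> tr tr0 tr1 sr.
have e0 : 0 < `|t - r| by rewrite normr_gt0 subr_eq0.
have := ler_norm (t - r); have := lerNnormlW (lexx `|t - r|).
have := ler_norm (s - r); have := lerNnormlW (lexx `|s - r|).
move=> v1 v2 w1 w2.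
have bit (p q y : R) : 0 < p -> 0 < q -> 0 <= y <= 4 * q -> q <= 2 * p ->
    p * (Num.sqrt y / Num.sqrt q)
      <= p * (1 + y / q) / 2 - (y - q) ^+ 2 / q / 36.
  move=> p0 q0 /andP[y0 y4] qp.
  rewrite -sqrtrV ?(ltW q0) // -sqrtrM //.
  have yq : 0 <= y / q <= 4.
    by rewrite ler_pdivrMr // y4 andbT divr_ge0 // ltW.
  apply: le_trans (ler_wpM2l (ltW p0) (sqrt_le_parabola yq)) _.
  have -> : y / q - 1 = (y - q) / q by rewrite mulrBl divff ?gt_eqF.
  rewrite mulrBr -mulrA lerD2l lerN2 exprMn.
  have -> : p * ((y - q) ^+ 2 * q^-1 ^+ 2 / 18)
          = ((y - q) ^+ 2 / q / 36) * (2 * p / q).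
    by field; rewrite gt_eqF.
  have pq : 1 <= 2 * p / q by rewrite ler_pdivlMr ?mul1r.
  rewrite ler_peMr // divr_ge0 //.
  by rewrite divr_ge0 ?sqr_ge0 ?(ltW q0).
rewrite /affinity big_bool /=.
have s0 : 0 < s by lra.
have s1 : 0 < 1 - s by lra.
have b1 := bit r s t (ltac:(lra)) s0 (ltac:(lra)) (ltac:(lra)).
have b2 := bit (1 - r) (1 - s) (1 - t) (ltac:(lra)) s1 (ltac:(lra)) (ltac:(lra)).
apply: le_trans (lerD b1 b2) _.
set I := s^-1 + (1 - s)^-1.
(* I is the inverse of the variance s (1 - s). *)
have I2 : 2 <= I.
  have : 1 <= s^-1 by rewrite invr_ge1 ?unitfE ?gt_eqF //; lra.
  have : 1 <= (1 - s)^-1 by rewrite invr_ge1 ?unitfE ?gt_eqF //; lra.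
  rewrite /I; lra.
have -> : r * (1 + t / s) / 2 - (t - s) ^+ 2 / s / 36 +
  ((1 - r) * (1 + (1 - t) / (1 - s)) / 2
   - (1 - t - (1 - s)) ^+ 2 / (1 - s) / 36)
  = 1 - I * ((t - s) ^+ 2 / 36 + (s - r) * (t - s) / 2).
  by rewrite /I; field; rewrite !gt_eqF.
rewrite lerD2l lerN2.
have X : (t - r) ^+ 2 / 72 <= (t - s) ^+ 2 / 36 + (s - r) * (t - s) / 2.
  have sq1 : 4096 * (s - r) ^+ 2 <= (t - r) ^+ 2.
    rewrite -(real_normK (num_real (s - r))) -(real_normK (num_real (t - r))).
    have := normr_ge0 (s - r); nra.
  have pr : - ((t - r) ^+ 2) <= 64 * ((s - r) * (t - r)).
    have := sqr_ge0 (64 * (s - r) + (t - r)); lra.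
  by have := sqr_ge0 (t - r); lra.
have := sqr_ge0 (t - r); nra.
Qed.

(** * Sums of capped geometric sequences *)

Lemma sum_geometric_le (R : realType) (d : R) (N : nat) :
  0 < d <= 1 -> \sum_(0 <= n < N) (1 - d) ^+ n <= d^-1.
Proof.
move=> /andP[d0 d1]; rewrite -[d^-1]mul1r ler_pdivlMr //.
suff -> : (\sum_(0 <= n < N) (1 - d) ^+ n) * d = 1 - (1 - d) ^+ N.
  by rewrite gerBl exprn_ge0 // subr_ge0.
elim: N => [|N IHN]; first by rewrite big_nil mul0r expr0 subrr.
by rewrite big_nat_recr //= mulrDl IHN exprS; ring.
Qed.

Lemma ln2_ge_half (R : realType) : 1 / 2 <= ln 2 :> R.
Proof.
have h : expR (1 / 2) <= 2 :> R.
  have := expR_ge1Dx (- (1 / 2) : R).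
  rewrite expRN -[X in _ <= X]mul1r ler_pdivlMr ?expR_gt0 //; lra.
by rewrite -ler_expR lnK ?posrE.
Qed.

Lemma ln2_le1 (R : realType) : ln 2 <= 1 :> R.
Proof. by have := @le_ln1Dx R 1; apply; rewrite (lt_trans (ltrN10 _)). Qed.

(** Turns an exponential rate into a geometric ratio of the form required by
[sum_capped_geometric_le]. *)
Lemma expRN_le_chord (R : realType) (d : R) : 0 <= d <= 1 -> expR (- d) <= 1 - d / 2.
Proof.
move=> /andP[d0 d1]; have d1' : 0 < 1 + d by lra.
rewrite expRN; apply: (@le_trans _ _ (1 + d)^-1).
  by rewrite lef_pV2 ?posrE ?expR_gt0 // expR_ge1Dx.
rewrite -[X in X <= _]mul1r ler_pdivrMr //; nra.
Qed.

(** The cap [1] is the better bound for the first [b / d] indices; from then on the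
prefactor [expR b] has been absorbed and a geometric series of ratio [1 - d] is
left.  So a large prefactor costs only its logarithm. *)
Lemma sum_capped_geometric_le (R : realType) (p : nat -> R) (b d : R) (i N : nat) :
  0 <= b -> 0 < d <= 1 ->
  (forall n, (i <= n)%N -> p n <= 1) ->
  (forall n, (i <= n)%N -> p n <= expR b * (1 - d) ^+ n) ->
  \sum_(i <= n < N) p n <= (b + 2) / d.
Proof.
move=> b0 d01 p1 pd; have [d0 d1] := andP d01.
have bd0 : 0 <= b / d by rewrite divr_ge0 // ltW.
have /andP[mle mlt] := truncn_itv bd0; set m := Num.truncn (b / d) in mle mlt.
pose q n : R := if (n <= m)%N then 1 else (1 - d) ^+ (n - m.+1).
have q0 n : 0 <= q n by rewrite /q; case: ifP => // _; rewrite exprn_ge0 // subr_ge0.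
have pq n : (i <= n)%N -> p n <= q n.
  move=> ni; rewrite /q; case: leqP => nm; first exact: p1.
  apply: le_trans (pd n ni) _; rewrite -{1}(subnKC nm) exprD mulrA.
  rewrite ler_piMl ?exprn_ge0 ?subr_ge0 //.
  have h : (1 - d) ^+ m.+1 <= expR (- d) ^+ m.+1.
    by rewrite lerXn2r ?nnegrE ?expR_ge0 ?subr_ge0 // (le_trans _ (expR_ge1Dx _)).
  apply: le_trans (ler_wpM2l (expR_ge0 _) h) _.
  (* Index m + 1 exceeds b / d, so the factor expR b is used up there. *)
  rewrite -expRM_natl -expRD -[X in _ <= X]expR0 ler_expR mulrN subr_le0.
  by rewrite -ler_pdivrMr // ltW.
apply: (@le_trans _ _ (\sum_(0 <= n < m.+1 + N) q n)).
  have [iN|Ni] := leqP i N; last first.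
    by rewrite big_geq ?(ltnW Ni) //; apply: sumr_ge0.
  apply: (@le_trans _ _ (\sum_(i <= n < N) q n)).
    by apply: ler_sum_nat => n /andP[ni _]; apply: pq.
  rewrite (@big_cat_nat _ _ _ i 0) //=; last by rewrite (leq_trans iN) // leq_addl.
  rewrite (@big_cat_nat _ _ _ N i (m.+1 + N)%N) //= ?leq_addl //.
  by rewrite addrCA lerDl addr_ge0 ?sumr_ge0.
rewrite (@big_cat_nat _ _ _ m.+1) ?leq_addr //=.
rewrite -{2}[m.+1]add0n big_addn addKn.
have -> : \sum_(0 <= n < m.+1) q n = m.+1%:R.
  rewrite (eq_big_nat _ _ (F2 := fun=> 1)); last first.
    by move=> n /andP[_]; rewrite /q ltnS => ->.
  by rewrite sumr_const_nat subn0.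
have -> : \sum_(0 <= n < N) q (n + m.+1)%N = \sum_(0 <= n < N) (1 - d) ^+ n.
  by apply: eq_bigr => n _; rewrite /q addnS ltnNge leq_addl /= -addnS addnK.
have := sum_geometric_le N d01; rewrite mulrDl -natr1.
have : 1 <= d^-1 by rewrite invr_ge1 ?unitfE ?gt_eqF.
lra.
Qed.

(** * The least complexity near the true parameter *)

(** An infimum, since the complexities are arbitrary reals and a minimizer need not
exist. *)
Definition complexity_profile (R : realType) (Theta : set R) (Kw : R -> R)
    (theta0 : R) (k : nat) : R :=
  inf (Kw @` [set t | Theta t /\ `|t - theta0| <= 2 ^- k]).

Section ComplexityProfile.
Context (R : realType) (Theta : set R) (Kw : R -> R) (theta0 : R).
Hypotheses (Kw_ge0 : forall t, Theta t -> 0 <= Kw t) (theta0_in : Theta theta0).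
Local Notation profile := (complexity_profile Theta Kw theta0).

Let near_lb k :
  lbound (Kw @` [set t | Theta t /\ `|t - theta0| <= 2 ^- k]) 0.
Proof. by move=> _ [t [Tt _] <-]; apply: Kw_ge0. Qed.

Let near_nonempty k :
  (Kw @` [set t | Theta t /\ `|t - theta0| <= 2 ^- k]) !=set0.
Proof.
exists (Kw theta0), theta0 => //; split => //.
by rewrite subrr normr0 invr_ge0 exprn_ge0.
Qed.

Lemma complexity_profile_le k t :
  Theta t -> `|t - theta0| <= 2 ^- k -> profile k <= Kw t.
Proof.
move=> Tt tk; apply: ge_inf; first by exists 0; apply: near_lb.
by exists t.
Qed.

Lemma complexity_profile_ge0 k : 0 <= profile k.
Proof. exact: lb_le_inf (near_nonempty k) (@near_lb k). Qed.

Lemma complexity_profile_le_center k : profile k <= Kw theta0.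
Proof.
by apply: complexity_profile_le => //; rewrite subrr normr0 invr_ge0 exprn_ge0.
Qed.

Lemma complexity_profile_approx k (eps : R) : 0 < eps ->
  exists2 t, Theta t /\ `|t - theta0| <= 2 ^- k & Kw t < profile k + eps.
Proof.
move=> eps0; have hi : has_inf (Kw @` [set t | Theta t /\ `|t - theta0| <= 2 ^- k]).
  by split; [exact: near_nonempty|exists 0; apply: near_lb].
by have [_ [t tk <-] tlt] := inf_adherent eps0 hi; exists t.
Qed.

Lemma complexity_profile_leS k : profile k <= profile k.+1.
Proof.
apply: lb_le_inf (near_nonempty _) _ => _ [t [Tt tk] <-].
apply: complexity_profile_le => //; apply: le_trans tk _.
by rewrite lef_pV2 ?posrE ?exprn_gt0 // exprS ler_peMl ?exprn_ge0 ?ler1n.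
Qed.

Lemma complexity_profile_nd : {homo profile : i j / (i <= j)%N >-> i <= j}.
Proof. by apply: homo_leq => [//|? ? ?|?]; [exact: le_trans|exact: complexity_profile_leS]. Qed.

(** Telescoping with step [s]: only the [s] last values survive, each at most the
complexity of the true parameter. *)
Lemma sum_complexity_profile_increments (s T : nat) :
  \sum_(0 <= k < T) (profile (k + s) - profile k) <= s%:R * Kw theta0.
Proof.
have -> : s%:R * Kw theta0 = \sum_(0 <= i < s) Kw theta0.
  by rewrite sumr_const_nat subn0 mulr_natl.
apply: (@le_trans _ _ (\sum_(0 <= i < s) (profile (T + i) - profile i))); last first.
  apply: ler_sum => i _; have := complexity_profile_ge0 i.
  have := complexity_profile_le_center (T + i); lra.
rewrite !sumrB.
have E : \sum_(0 <= k < T) profile k + \sum_(0 <= i < s) profile (T + i)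
  = \sum_(0 <= k < s) profile k + \sum_(0 <= k < T) profile (k + s).
  have split i j : \sum_(0 <= k < i + j) profile k
     = \sum_(0 <= k < i) profile k + \sum_(0 <= k < j) profile (k + i).
    rewrite (@big_cat_nat _ _ _ i) ?leq_addr //=; congr (_ + _).
    by rewrite -{1}[i]add0n big_addn addKn.
  rewrite -split addnC split; congr (_ + _).
  by apply: eq_bigr => i _; rewrite addnC.
lra.
Qed.

End ComplexityProfile.

(** * Dyadic shells around the true parameter *)

(** Dividing by [e] lets one formula serve both sides of [theta0]: the sign of [e]
selects the side. *)
Definition one_sided_shell (R : realType) (theta0 e : R) : pred R :=
  fun t => 1 < (t - theta0) / e <= 2.

Definition shell_mass (R : realType) (theta0 : R) (est : seq bool -> R)
    (e : R) (n : nat) : R :=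
  \sum_(x : n.-tuple bool | one_sided_shell theta0 e (est x)) likelihood x theta0.

(** Either [t] is in one of the first [T] shells, or it is so close to [theta0]
that the remainder [2 ^- T] covers it.  Truncating keeps all sums over scales
finite. *)
Lemma sq_le_sum_shells (R : realType) (theta0 t : R) (T : nat) :
  `|t - theta0| <= 1 ->
  (theta0 - t) ^+ 2 <=
    \sum_(0 <= k < T) (2 ^- k) ^+ 2 *
       ((one_sided_shell theta0 (2 ^- k.+1) t)%:R +
        (one_sided_shell theta0 (- 2 ^- k.+1) t)%:R) + 2 ^- T.
Proof.
move=> t1; pose f k : R := (2 ^- k) ^+ 2 *
  ((one_sided_shell theta0 (2 ^- k.+1) t)%:R +
   (one_sided_shell theta0 (- 2 ^- k.+1) t)%:R).
rewrite -[\sum_(0 <= k < T) _]/(\sum_(0 <= k < T) f k).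
have f0 k : 0 <= f k by rewrite mulr_ge0 ?sqr_ge0 ?addr_ge0.
have h0 k : 0 < 2 ^- k :> R by rewrite invr_gt0 exprn_gt0.
have h1 k : 2 ^- k.+1 * 2 = 2 ^- k :> R by rewrite exprS invfM mulrAC mulVf ?mul1r ?pnatr_eq0.
have Lk1 k : 2 ^- k <= 1 :> R by rewrite invf_le1 ?exprn_gt0 // exprn_ege1 // ler1n.
rewrite -sqrrN opprB -(real_normK (num_real _)).
have [|small] : `|t - theta0| ^+ 2 <= \sum_(0 <= k < T) f k \/ `|t - theta0| <= 2 ^- T.
- elim: T => [|T [IH|IH]]; first by right; rewrite expr0 invr1.
    by left; rewrite big_nat_recr //= (le_trans IH) // lerDl.
  have [|far] := lerP (`|t - theta0|) (2 ^- T.+1); first by right.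
  left; rewrite big_nat_recr //= (@le_trans _ _ (f T)) //; last first.
    by rewrite lerDr sumr_ge0.
  apply: (@le_trans _ _ ((2 ^- T) ^+ 2)); first by rewrite lerXn2r ?nnegrE ?(ltW (h0 _)).
  rewrite /f ler_peMr ?sqr_ge0 // /one_sided_shell.
  have side (x : R) : 2 ^- T.+1 < x -> x <= 2 ^- T -> 1 < x / 2 ^- T.+1 <= 2.
    by move=> ex xe; rewrite ltr_pdivlMr // ler_pdivrMr // mul1r ex mulrC h1.
  have [pos|neg] := lerP 0 (t - theta0).
    rewrite (ger0_norm pos) in far IH.
    by rewrite (side _ far IH) /= lerDl.
  rewrite (ltr0_norm neg) in far IH.
  by rewrite invrN mulrN -mulNr (side _ far IH) /= lerDr.
- by move/le_trans; apply; rewrite lerDl ltW.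
rewrite (@le_trans _ _ (2 ^- T)) ?lerDr ?sumr_ge0 //.
apply: le_trans small; rewrite expr2 ler_piMl // (le_trans small) //.
Qed.

Lemma shell_mass_le1 (R : realType) (theta0 : R) est e n :
  0 <= theta0 <= 1 -> shell_mass theta0 est e n <= 1.
Proof.
move=> t01; rewrite -(sum_likelihood n theta0).
rewrite [leRHS](bigID (fun x : n.-tuple bool => one_sided_shell theta0 e (est x))) /=.
by rewrite lerDl; apply: sumr_ge0 => x _; apply: likelihood_ge0.
Qed.

Lemma one_sided_shell_dist (R : realType) (theta0 e t : R) :
  e != 0 -> one_sided_shell theta0 e t ->
  `|e| < `|t - theta0| <= 2 * `|e|.
Proof.
move=> e0 /andP[h1 h2]; have ee : 0 < `|e| by rewrite normr_gt0.
have -> : `|t - theta0| = (t - theta0) / e * `|e|.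
  by rewrite -[X in X * _]ger0_norm ?(le_trans ler01 (ltW h1)) // normrM normfV divfK ?gt_eqF.
by rewrite ltr_pMl // h1 ler_pM2r.
Qed.

(** Measured from [theta0], the competitor is at [v], the estimate at [d], and the
point [e] of the segment between them has weight [(e - v) / (d - v)] on [d].  The
lower bound on the weight keeps a fixed share of the complexity gap when that gap
works against the estimate. *)
Lemma segment_weight (R : realType) (e v d : R) :
  e != 0 -> 64 * `|v| <= `|e| -> 1 < d / e <= 2 ->
  [/\ d - v != 0, 1 / 3 <= (e - v) / (d - v) & (e - v) / (d - v) < 1].
Proof.
move=> e0 ve /andP[d1 d2].
set w := v / e; set u := d / e in d1 d2.
have vE : v = w * e by rewrite divfK.
have dE : d = u * e by rewrite divfK.
have w64 : 64 * `|w| <= 1.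
  by rewrite normrM normfV mulrA ler_pdivrMr ?normr_gt0 // mul1r.
have := ler_norm w; have := lerNnormlW (lexx `|w|) => w1 w2.
have uw : 0 < u - w by lra.
have -> : (e - v) / (d - v) = (1 - w) / (u - w).
  rewrite vE dE -mulrBl -[X in X - _]mul1r -mulrBl invfM mulrACA divff // mulr1 //.
split; first by rewrite vE dE -mulrBl mulf_neq0 ?(gt_eqF uw).
  by rewrite ler_pdivlMr //; lra.
by rewrite ltr_pdivrMr // mul1r; lra.
Qed.

(** * Probability that the estimator falls in a shell *)

Section Setting.
Context (R : realType) (Theta : set R) (Kw : R -> R) (theta0 : R).
Context (est : seq bool -> R) (a b : R).
Hypothesis mdl : mdl_setting Theta Kw theta0 est a b.

Let mdl01 t : Theta t -> 0 <= t <= 1.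
Proof. by move/(mdl_Theta01 mdl); rewrite /= in_itv. Qed.

Let center01 : 0 <= theta0 <= 1.
Proof. exact: mdl01 (mdl_theta0 mdl). Qed.

Let est_in x : x != [::] -> Theta (est x).
Proof. by case/(mdl_est mdl). Qed.

(** The empty string is excluded because the estimator is unconstrained there;
below this shows as lengths [n.+1]. *)
Lemma mdl_likelihood_ge (x : seq bool) (s : R) : x != [::] -> Theta s ->
  expR (ln 2 * (Kw (est x) - Kw s)) * likelihood x s <= likelihood x (est x).
Proof.
move=> x0 Ts; have [_ /(_ s Ts)] := mdl_est mdl x0.
rewrite /weight /powR pnatr_eq0 /= !mulNr !expRN.
rewrite mulrBr expRD expRN ![_ * ln 2]mulrC => H.
rewrite -mulrA -(ler_pM2l (_ : 0 < (expR (ln 2 * Kw (est x)))^-1)).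
  by rewrite mulKf ?gt_eqF ?expR_gt0.
by rewrite invr_gt0 expR_gt0.
Qed.

Lemma shell_mass_outside (e : R) (n : nat) :
  e != 0 -> ~~ (0 <= theta0 + e <= 1) -> shell_mass theta0 est e n.+1 = 0.
Proof.
move=> e0 out; rewrite /shell_mass big_pred0 // => x; apply/negP.
rewrite /one_sided_shell => /andP[].
have /mdl01/andP[t0 t1] : Theta (est x) by apply: est_in; case/tupleP: x.
have [c0 c1] := andP center01.
case: (ltrgt0P e) e0 => // e0 _.
  rewrite ltr_pdivlMr // => h _; move/negP: out; apply; apply/andP; lra.
rewrite ltr_ndivlMr // => h _; move/negP: out; apply; apply/andP; lra.
Qed.

(** The common bound for all shells.  The competitor [s] and the exponent [c] are
free: [c] is any lower bound for the log-ratio of the likelihoods at [theta0 + e]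
and [s] that the weights enforce.  It is negative when candidates in the shell may
be simpler than [s]. *)
Lemma shell_mass_le_affinity (e s c : R) (n : nat) :
  e != 0 -> 0 <= theta0 + e <= 1 ->
  Theta s -> 64 * `|s - theta0| <= `|e| ->
  (s = 0 -> theta0 = 0) -> (s = 1 -> theta0 = 1) ->
  (forall t l, Theta t -> one_sided_shell theta0 e t -> 1 / 3 <= l < 1 ->
     c <= l * (ln 2 * (Kw t - Kw s))) ->
  shell_mass theta0 est e n.+1
    <= expR (- (c / 2)) * affinity theta0 s (theta0 + e) ^+ n.+1.
Proof.
move=> e0 e01 Ts se s0 s1 cl; have s01 := mdl01 Ts.
apply: likelihood_ratio_tail => // x xe.
have x0 : val x != [::] by case/tupleP: x {xe}.
have Tx := est_in x0.
have [dv l13 l1] := segment_weight e0 se xe.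
set d := est x - theta0 in dv l13 l1; set v := s - theta0 in dv l13 l1.
set l := (e - v) / (d - v) in l13 l1.
have l01 : 0 < l < 1 by lra.
have := likelihood_ratio_segment l01 s01 (mdl01 Tx) (mdl_likelihood_ge x0 Ts).
have -> : (1 - l) * s + l * est x = theta0 + e.
  have : l * (d - v) = e - v by rewrite divfK.
  by rewrite /d /v; lra.
apply: le_trans; rewrite ler_wpM2r ?likelihood_ge0 // ler_expR.
by apply: cl => //; rewrite l13.
Qed.

Let a1 : 1 <= a. Proof. exact: mdl_a_ge1 mdl. Qed.
Let a0 : 0 < a. Proof. exact: lt_le_trans a1. Qed.
Let K00 : 0 <= Kw theta0. Proof. exact: mdl_Kw_ge0 mdl _ (mdl_theta0 mdl). Qed.

Local Notation M := (a * Kw theta0 + b).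
Local Notation profile := (complexity_profile Theta Kw theta0).
Local Notation rate := (ln 2 / (6 * a)).

Let M0 : 0 <= M.
Proof. by rewrite addr_ge0 ?(mdl_b_ge0 mdl) ?mulr_ge0 ?(ltW a0). Qed.

Let ln2_gt0 : 0 < ln 2 :> R.
Proof. by have := ln2_ge_half R; lra. Qed.

Lemma complexity_growth_ge (k : nat) (t : R) : M < k%:R ->
  Theta t -> t != theta0 -> `|t - theta0| <= 2 ^- k -> (k%:R - b) / a <= Kw t.
Proof.
move=> Mk Tt tn tk; rewrite -lee_fin.
apply: le_trans (mdl_growth mdl Mk) _; apply: ereal_inf_lbound.
by exists t => //; split => //; move: tk; rewrite ler_distl.
Qed.

(* Inserts a bound on the affinity into shell_mass_le_affinity. *)
Let affinity_pow (s t q c : R) (n : nat) :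
  affinity theta0 s t <= q ->
  expR c * affinity theta0 s t ^+ n <= expR c * q ^+ n.
Proof.
move=> aq; have A0 : 0 <= affinity theta0 s t.
  apply: sumr_ge0 => i _; rewrite mulr_ge0 ?divr_ge0 ?sqrtr_ge0 //.
  exact: bernoulli_mass_ge0.
by rewrite ler_wpM2l ?expR_ge0 // lerXn2r ?nnegrE // (le_trans A0).
Qed.

(** Fine scales, competitor [theta0]: every candidate in the shell is more complex
than [theta0] by [(k - M) / a].  One third of this gap survives the passage to
[theta0 + e], and half of that the square root, whence the 6 in the rate. *)
Lemma shell_mass_le_of_growth (k n : nat) (e : R) : M < k%:R ->
  `|e| = 2 ^- k.+1 -> 0 <= theta0 + e <= 1 ->
  shell_mass theta0 est e n.+1
    <= expR (- (rate * (k%:R - M))) * (1 - e ^+ 2 / 4) ^+ n.+1.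
Proof.
move=> Mk ek e01; have e0 : e != 0 by rewrite -normr_gt0 ek invr_gt0 exprn_gt0.
have -> : rate * (k%:R - M) = 1 / 3 * (ln 2 * ((k%:R - M) / a)) / 2.
  by field; rewrite gt_eqF.
have aff := affinity_diag_le center01 e01.
rewrite (addrC theta0) addrK addrC in aff.
apply: le_trans (affinity_pow _ _ aff).
apply: shell_mass_le_affinity => //.
- exact: mdl_theta0 mdl.
- by rewrite subrr normr0 mulr0.
move=> t l Tt te /andP[l13 _]; have /andP[t1 t2] := one_sided_shell_dist e0 te.
have tn : t != theta0.
  by rewrite -subr_eq0 -normr_gt0 (lt_trans _ t1) // normr_gt0.
have K := complexity_growth_ge Mk Tt tn.
have {}K : (k%:R - b) / a <= Kw t.
  apply: K; apply: le_trans t2 _.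
  by rewrite ek exprS invfM mulrA divff ?mul1r // pnatr_eq0.
have D : (k%:R - M) / a <= Kw t - Kw theta0.
  have -> : (k%:R - M) / a = (k%:R - b) / a - Kw theta0 by field; rewrite gt_eqF.
  by rewrite lerD2r.
have D0 : 0 <= (k%:R - M) / a by rewrite divr_ge0 ?ltW ?subr_gt0.
apply: ler_pM => //; last by rewrite ler_pM2l.
by rewrite mulr_ge0 // ltW.
Qed.

(** Competitor [theta0]: complexities being nonnegative, the weights favour the
estimate by a factor [2 ^ Kw theta0] at most, which the linear affinity deficit
makes affordable. *)
Lemma shell_mass_le_near_boundary (n : nat) (e : R) :
  e != 0 -> 0 <= theta0 + e <= 1 ->
  theta0 < `|e| \/ 1 - theta0 < `|e| ->
  shell_mass theta0 est e n.+1
    <= expR (ln 2 * Kw theta0 / 2) * (1 - `|e| / 12) ^+ n.+1.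
Proof.
move=> e0 e01 far.
have ee : theta0 + e - theta0 = e by rewrite addrC addKr.
have aff := affinity_boundary_le center01 e01; rewrite ee in aff.
apply: le_trans (affinity_pow _ _ (aff far)).
rewrite -[ln 2 * _ / 2]opprK -mulNr.
apply: shell_mass_le_affinity => //.
- exact: mdl_theta0 mdl.
- by rewrite subrr normr0 mulr0.
move=> t l Tt _ /andP[l13 l1]; have Kt := mdl_Kw_ge0 mdl Tt.
rewrite -mulrN mulrCA ler_pM2l //.
have := mulr_ge0 (_ : 0 <= l) Kt; have := mulr_ge0 (_ : 0 <= 1 - l) K00; lra.
Qed.

(** The competitor is a nearly simplest parameter at scale [2 ^- (k + 7)]; the shift
7 puts it within [|e| / 64] of [theta0], as [affinity_interior_le] requires, and the
summand 1 is the slack in the infimum. *)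
Lemma shell_mass_le_inside (k n : nat) (e : R) :
  `|e| = 2 ^- k.+1 -> `|e| <= theta0 -> `|e| <= 1 - theta0 ->
  shell_mass theta0 est e n.+1
    <= expR (ln 2 * (profile (k + 7) - profile k + 1) / 2)
       * (1 - e ^+ 2 / 36) ^+ n.+1.
Proof.
move=> ek et et1; have e0 : e != 0 by rewrite -normr_gt0 ek invr_gt0 exprn_gt0.
have ee : theta0 + e - theta0 = e by rewrite addrC addKr.
have e01 : 0 <= theta0 + e <= 1.
  by have := ler_norm e; have := lerNnormlW (lexx `|e|); lra.
have ep : 0 < `|e| by rewrite normr_gt0.
have [s [Ts sk] Ks] := complexity_profile_approx (mdl_Kw_ge0 mdl)
  (mdl_theta0 mdl) (k + 7) (ltr01 : 0 < 1 :> R).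
have se : 64 * `|s - theta0| <= `|e|.
  rewrite ek; have -> : 2 ^- k.+1 = 64 * 2 ^- (k + 7) :> R.
    by rewrite -addSnnS exprD invfM mulrCA (_ : 64 = 2 ^+ 6) ?divff ?mulr1 // -?natrX // expf_neq0 ?pnatr_eq0.
  by rewrite ler_pM2l.
have aff : affinity theta0 s (theta0 + e) <= 1 - e ^+ 2 / 36.
  have := @affinity_interior_le R theta0 s (theta0 + e).
  by rewrite ee => -> //; rewrite -subr_eq0 ee.
apply: le_trans (affinity_pow _ _ aff).
rewrite -[ln 2 * _ / 2]opprK -mulNr.
have := ler_norm (s - theta0); have := lerNnormlW (lexx `|s - theta0|) => v1 v2.
(* lra also settles s = 0 and s = 1: as |s - theta0| is at most 1/64 of both
   theta0 and 1 - theta0, these force theta0 = s. *)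
apply: shell_mass_le_affinity => //; try lra.
move=> t l Tt te /andP[l13 l1].
have /andP[t1 t2] := one_sided_shell_dist e0 te.
have kt : profile k <= Kw t.
  apply: (complexity_profile_le (mdl_Kw_ge0 mdl)) => //.
  apply: le_trans t2 _.
  by rewrite ek exprS invfM mulrA divff ?mul1r // pnatr_eq0.
have kk : profile k <= profile (k + 7).
  apply: (complexity_profile_nd (mdl_Kw_ge0 mdl) (mdl_theta0 mdl)).
  exact: leq_addr.
rewrite -mulrN mulrCA ler_pM2l //.
have := mulr_ge0 (_ : 0 <= l) (_ : 0 <= Kw t - profile k).
have := mulr_ge0 (_ : 0 <= l) (_ : 0 <= profile (k + 7) + 1 - Kw s).
have := mulr_ge0 (_ : 0 <= 1 - l) (_ : 0 <= profile (k + 7) - profile k + 1).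
lra.
Qed.

Definition scale_decay (k : nat) : R :=
  if k%:R <= M then 1 else expR (- (rate * (k%:R - M))).

(** The three summands pay for the fine shells (and for the constant cost of the
coarse ones), for the shells near the boundary and for the inner shells. *)
Definition shell_budget (k : nat) : R :=
  scale_decay k +
  2 ^- k * Kw theta0 + (profile (k + 7) - profile k).

(** In each of the three regimes the decay rate in [n] compensates the weight
[4^-k = 4 * e^2]: it is of order [e^2], or even [|e|] near the boundary. *)
Lemma sum_shell_mass_le (k N : nat) (e : R) : `|e| = 2 ^- k.+1 ->
  (2 ^- k) ^+ 2 * \sum_(1 <= n < N) shell_mass theta0 est e n
    <= 360 * shell_budget k.
Proof.
move=> ek; have ep : 0 < `|e| by rewrite ek invr_gt0 exprn_gt0.
have e0 : e != 0 by rewrite -normr_gt0.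
have kE : 2 ^- k = 2 * `|e|.
  by rewrite ek exprS invfM mulrA divff ?mul1r // pnatr_eq0.
have eh : `|e| <= 1 / 2.
  have : 2 ^- k <= 1 :> R by rewrite invf_le1 ?exprn_gt0 // exprn_ege1 // ler1n.
  by rewrite kE; lra.
have sqE : (2 ^- k) ^+ 2 = 4 * e ^+ 2 by rewrite kE exprMn real_normK ?num_real // -natrX.
have e2 : 0 < e ^+ 2 by rewrite -(real_normK (num_real e)) exprn_gt0.
have e4 : 0 <= 4 * e ^+ 2 by rewrite mulr_ge0 // ltW.
have e21 : e ^+ 2 <= 1 / 4.
  by rewrite -(real_normK (num_real e)) expr2; have := ler_pM (ltW ep) (ltW ep) eh eh; lra.
have inc0 : 0 <= profile (k + 7) - profile k.
  rewrite subr_ge0; apply: (complexity_profile_nd (mdl_Kw_ge0 mdl) (mdl_theta0 mdl)).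
  exact: leq_addr.
have KK : 0 <= 2 ^- k * Kw theta0 by rewrite mulr_ge0 // kE mulr_ge0 // ltW.
have ln2 := ln2_le1 R.
have budget0 : 0 <= shell_budget k.
  apply: addr_ge0 inc0; apply: addr_ge0 KK.
  by rewrite /scale_decay; case: ifP => // _; exact: expR_ge0.
have [in01|out] := boolP (0 <= theta0 + e <= 1); last first.
  rewrite big_nat big1 => [|[//|n] _]; last exact: shell_mass_outside.
  by rewrite mulr0 mulr_ge0 ?ler0n.
have mass1 n : (1 <= n)%N -> shell_mass theta0 est e n <= 1.
  by move=> _; apply: shell_mass_le1.
rewrite /shell_budget /scale_decay sqE; case: (lerP k%:R M) => [kM|Mk].
  have [far|] := boolP ((theta0 < `|e|) || (1 - theta0 < `|e|)).
    have mass n : (1 <= n)%N -> shell_mass theta0 est e n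
        <= expR (ln 2 * Kw theta0 / 2) * (1 - `|e| / 12) ^+ n.
      case: n => // n _; apply: shell_mass_le_near_boundary => //.
      by case/orP: far; [left|right].
    have b0 : 0 <= ln 2 * Kw theta0 / 2 by rewrite divr_ge0 ?mulr_ge0 ?(ltW ln2_gt0).
    have d0 : 0 < `|e| / 12 <= 1 by apply/andP; split; lra.
    have := sum_capped_geometric_le N b0 d0 mass1 mass.
    move/(ler_wpM2l e4).
    have -> x : 4 * e ^+ 2 * (x / (`|e| / 12)) = 48 * `|e| * x.
      by rewrite -(real_normK (num_real e)); field; rewrite gt_eqF.
    have := ler_wpM2l (ltW ep) (ler_piMl K00 ln2); rewrite kE.
    have := mulr_ge0 (ltW ep) K00; lra.
  rewrite negb_or -!leNgt => /andP[le0 le1].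
  have mass n : (1 <= n)%N -> shell_mass theta0 est e n
      <= expR (ln 2 * (profile (k + 7) - profile k + 1) / 2) * (1 - e ^+ 2 / 36) ^+ n.
    by case: n => // n _; apply: shell_mass_le_inside.
  have b0 : 0 <= ln 2 * (profile (k + 7) - profile k + 1) / 2.
    rewrite divr_ge0 // mulr_ge0 ?(ltW ln2_gt0) //.
    by rewrite addr_ge0 // ler01.
  have d0 : 0 < e ^+ 2 / 36 <= 1 by apply/andP; split; lra.
  have := ler_wpM2l e4 (sum_capped_geometric_le N b0 d0 mass1 mass).
  have -> x : 4 * e ^+ 2 * (x / (e ^+ 2 / 36)) = 144 * x.
    by field; rewrite ?e0.
  have := ler_piMl (addr_ge0 inc0 ler01) ln2.
  lra.
set g := expR _.
have g0 : 0 <= g by exact: expR_ge0.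
have S : \sum_(1 <= n < N) shell_mass theta0 est e n <= g * (e ^+ 2 / 4)^-1.
  have d0 : 0 < e ^+ 2 / 4 <= 1 by apply/andP; split; lra.
  apply: le_trans (ler_wpM2l g0 (sum_geometric_le N d0)).
  have tail0 m p : 0 <= \sum_(m <= n < p) g * (1 - e ^+ 2 / 4) ^+ n.
    by apply: sumr_ge0 => n _; rewrite mulr_ge0 // exprn_ge0 //; lra.
  rewrite mulr_sumr; have [N1|N0] := leqP 1 N; last first.
    by rewrite [leLHS]big_geq // ltnW.
  rewrite [leRHS](@big_cat_nat _ _ _ 1) //= -[leLHS]add0r lerD //.
  apply: ler_sum_nat => -[//|n] _; exact: shell_mass_le_of_growth.
have := ler_wpM2l e4 S.
have -> : 4 * e ^+ 2 * (g * (e ^+ 2 / 4)^-1) = 16 * g by field; rewrite ?e0.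
lra.
Qed.

(** [M + 1] coarse scales and a tail of order [a] in the first summand, a geometric
series in the second, a telescoping sum in the third. *)
Lemma sum_shell_budget_le (T : nat) :
  \sum_(0 <= k < T) shell_budget k <= 11 * M + 48 * a.
Proof.
rewrite /shell_budget 2!big_split /= -mulr_suml.
have inc := sum_complexity_profile_increments (mdl_Kw_ge0 mdl) (mdl_theta0 mdl) 7 T.
have geo : \sum_(0 <= k < T) 2 ^- k <= 2 :> R.
  have := @sum_geometric_le R (1 / 2) T (ltac:(lra)).
  have -> : (1 / 2 : R)^-1 = 2 by field.
  apply: le_trans; apply: ler_sum => k _.
  by rewrite -exprVn (_ : 1 - 1 / 2 = 2^-1) //; lra.
have rate01 : 0 < rate <= 1.
  by rewrite divr_gt0 ?mulr_gt0 // ler_pdivrMr ?mulr_gt0 //; have := ln2_le1 R; have := a1; lra.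
have [rate0 rate1] := andP rate01.
have g1 k : (0 <= k)%N -> scale_decay k <= 1.
  move=> _; rewrite /scale_decay; case: (lerP k%:R M) => // Mk; rewrite -[leRHS]expR0 ler_expR.
  by rewrite oppr_le0 mulr_ge0 ?subr_ge0 ?(ltW Mk) ?(ltW rate0).
have gd k : (0 <= k)%N -> scale_decay k <= expR (rate * M) * (1 - rate / 2) ^+ k.
  move=> _; apply: (@le_trans _ _ (expR (- (rate * (k%:R - M))))).
    rewrite /scale_decay; case: (lerP k%:R M) => // kM; rewrite -[leLHS]expR0 ler_expR.
    by rewrite oppr_ge0 mulr_ge0_le0 ?subr_le0 ?(ltW rate0).
  have -> : - (rate * (k%:R - M)) = rate * M + k%:R * - rate by ring.
  rewrite expRD ler_wpM2l ?expR_ge0 // expRM_natl lerXn2r ?nnegrE ?expR_ge0 //; first lra.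
  by apply: expRN_le_chord; rewrite (ltW rate0).
have d0 : 0 < rate / 2 <= 1 by apply/andP; split; lra.
have := sum_capped_geometric_le T (mulr_ge0 (ltW rate0) M0) d0 g1 gd.
have -> : (rate * M + 2) / (rate / 2) = 2 * M + 24 * a / ln 2.
  by field; rewrite !gt_eqF.
have : 24 * a / ln 2 <= 48 * a.
  by rewrite ler_pdivrMr //; have := ln2_ge_half R; have := a0; nra.
have := ler_wpM2r K00 geo.
have : Kw theta0 <= M by have := mdl_b_ge0 mdl; have := ler_peMl K00 a1; lra.
lra.
Qed.

Lemma expected_sq_loss_le (n T : nat) :
  expectation_iid theta0 n.+1 (fun x => (theta0 - est x) ^+ 2)
    <= \sum_(0 <= k < T) (2 ^- k) ^+ 2 *
         (shell_mass theta0 est (2 ^- k.+1) n.+1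
          + shell_mass theta0 est (- 2 ^- k.+1) n.+1) + 2 ^- T.
Proof.
rewrite /expectation_iid.
apply: (@le_trans _ _ (\sum_(x : n.+1.-tuple bool) likelihood x theta0 *
    (\sum_(0 <= k < T) (2 ^- k) ^+ 2 *
       ((one_sided_shell theta0 (2 ^- k.+1) (est x))%:R +
        (one_sided_shell theta0 (- 2 ^- k.+1) (est x))%:R) + 2 ^- T))).
  apply: ler_sum => x _; rewrite ler_wpM2l ?likelihood_ge0 //.
  apply: sq_le_sum_shells.
  have /mdl01 : Theta (est x) by apply: est_in; case/tupleP: x.
  by rewrite ler_distl; move: center01; lra.
under eq_bigr do rewrite mulrDr.
rewrite big_split /= -mulr_suml sum_likelihood mul1r lerD2r.
under eq_bigr do rewrite mulr_sumr.
rewrite exchange_big /=; apply: ler_sum => k _.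
rewrite /shell_mass mulrDr !(big_mkcond (fun x => one_sided_shell _ _ _)) /= !mulr_sumr -big_split /=.
apply: ler_sum => x _; rewrite mulrCA mulrDr mulrDr.
by rewrite lerD // ler_wpM2l ?sqr_ge0 //; case: ifP => _; rewrite ?mulr1 ?mulr0.
Qed.

(** The truncation depth [T] is chosen after [N], so that the [N] remainders
[2 ^- T] together stay below any given [eps]. *)
Lemma partial_sq_loss_le (N : nat) :
  \sum_(1 <= n < N) expectation_iid theta0 n (fun x => (theta0 - est x) ^+ 2)
    <= 720 * (11 * M + 48 * a).
Proof.
apply/ler_addgt0Pr => eps eps0.
pose T := (Num.truncn (N%:R / eps)).+1.
have Nt : N%:R * 2 ^- T <= eps.
  have : N%:R / eps < T%:R by apply: truncnS_gt.
  rewrite ltr_pdivrMr // => NT; rewrite ler_pdivrMr ?exprn_gt0 //.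
  apply: le_trans (ltW NT) _; rewrite mulrC ler_wpM2l ?(ltW eps0) //.
  by rewrite -natrX ler_nat ltnW // ltn_expl.
apply: (@le_trans _ _ (\sum_(1 <= n < N) (\sum_(0 <= k < T) (2 ^- k) ^+ 2 *
         (shell_mass theta0 est (2 ^- k.+1) n
          + shell_mass theta0 est (- 2 ^- k.+1) n) + 2 ^- T))).
  by apply: ler_sum_nat => -[//|n] _; apply: expected_sq_loss_le.
rewrite big_split /= lerD //; last first.
  rewrite sumr_const_nat -[leLHS]mulr_natl (le_trans _ Nt) // ler_wpM2r ?invr_ge0 ?exprn_ge0 //.
  by rewrite ler_nat leq_subr.
rewrite exchange_big /=.
apply: (@le_trans _ _ (\sum_(0 <= k < T) 720 * shell_budget k)); last first.
  by rewrite -mulr_sumr ler_wpM2l ?ler0n // sum_shell_budget_le.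
apply: ler_sum => k _; rewrite -mulr_sumr big_split mulrDr /=.
have h0 : 0 <= 2 ^- k.+1 :> R by rewrite invr_ge0 exprn_ge0.
have := @sum_shell_mass_le k N _ (ger0_norm h0).
have := @sum_shell_mass_le k N _ (etrans (normrN _) (ger0_norm h0)).
lra.
Qed.

Lemma cumulative_sq_loss_le :
  (cumulative_sq_loss theta0 est <= (720 * (11 * M + 48 * a))%:E)%E.
Proof.
rewrite /cumulative_sq_loss; apply: lime_le.
  apply: is_cvg_nneseries => n _ _; rewrite lee_fin; apply: sumr_ge0 => x _.
  by rewrite mulr_ge0 ?likelihood_ge0 ?sqr_ge0.
by near=> N; rewrite sumEFin lee_fin; apply: partial_sq_loss_le.
Unshelve. all: by end_near. Qed.

End Setting.

(* In the first bound the constant is uniform over all settings, a and b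
   included; in the second one it depends on a and b.  As the right-hand sides
   can vanish, O(-) is read away from 0: for every kappa > 0, uniformly over the
   settings where K_w(theta0) + b / a, respectively K_w(theta0), is at least
   kappa. *)
Theorem theorem11 (R : realType) (kappa : R) (hkappa : 0 < kappa) :
  (exists C : R,
     forall (Theta : set R) (Kw : R -> R) (theta0 : R) (est : seq bool -> R)
            (a b : R),
       mdl_setting Theta Kw theta0 est a b ->
       kappa <= Kw theta0 + b / a ->
       (cumulative_sq_loss theta0 est <= (C * (a * Kw theta0 + b))%:E)%E)
  /\
  (forall a b : R,
     exists C : R,
       forall (Theta : set R) (Kw : R -> R) (theta0 : R) (est : seq bool -> R),
         mdl_setting Theta Kw theta0 est a b ->
         kappa <= Kw theta0 ->
         a * Kw theta0 + b <= C * Kw theta0).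
Proof.
split.
  exists (720 * (11 + 48 / kappa)) => Theta Kw theta0 est a b mdl kle.
  apply: le_trans (cumulative_sq_loss_le mdl) _.
  have a0 : 0 < a := lt_le_trans ltr01 (mdl_a_ge1 mdl).
  rewrite lee_fin -mulrA; apply: ler_wpM2l; first exact: ler0n.
  rewrite (mulrDl 11) lerD2l -mulrA; apply: ler_wpM2l; first exact: ler0n.
  rewrite mulrC ler_pdivlMr // (le_trans (ler_wpM2l (ltW a0) kle)) //.
  by rewrite mulrDr mulrCA divff ?mulr1 // gt_eqF.
move=> a b; exists (a + b / kappa) => Theta Kw theta0 est mdl kle.
rewrite mulrDl lerD2l -mulrA [_ * Kw _]mulrC mulrA ler_pdivlMr //.
by rewrite ler_wpM2l // (mdl_b_ge0 mdl).
Qed.
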